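(* The following determinant identities hold, the first for every integer $n\ge1$ and the other three for every integer $n\ge0$: (1) $$\det\left[\left(\sum_{k=0}^m\binom{\ell}{2k}\binom{2n-\ell}{2(m-k)+1}\right)_{\ell,m\in\{0,\dots,n-1\}}\right]=(-1)^{n(n-1)/2}\,2^{n(n-1)+1};$$ (2) $$\det\left[\left(\sum_{k=0}^m\binom{\ell}{2k}\binom{2n+1-\ell}{2(m-k)+1}\right)_{\ell,m\in\{0,\dots,n\}}\right]=(-1)^{n(n+1)/2}\,2^{n^2};$$ (3) $$\det\left[\left(\sum_{k=0}^m\binom{\ell}{2k}\binom{2n-\ell}{2(m-k)}\right)_{\ell,m\in\{0,\dots,n\}}\right]=(-1)^{n(n+1)/2}\,2^{n(n-1)};$$ (4) $$\det\left[\left(\sum_{k=0}^m\binom{\ell}{2k}\binom{2n+1-\ell}{2(m-k)}\right)_{\ell,m\in\{0,\dots,n\}}\right]=(-1)^{n(n+1)/2}\,2^{n^2}.$$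
   Context: $\binom{p}{q}$ is the usual binomial coefficient for non-negative integers, equal to $0$ if $q>p$. In each matrix $\ell$ is the row index and $m$ the column index. *)

(* Defs.v *)
From mathcomp Require Import all_boot all_order all_algebra.
Set Implicit Arguments.
Unset Strict Implicit.
Unset Printing Implicit Defensive.

(* Main.v *)
Require Import Defs.
From mathcomp Require Import all_boot all_order all_algebra.
From mathcomp Require Import zify ring.
Set Implicit Arguments.
Unset Strict Implicit.
Unset Printing Implicit Defensive.
Import GRing.Theory.
Local Open Scope ring_scope.

(** Put [y = x ^ 2], [E_k = ((1 + x) ^ k + (1 - x) ^ k) / 2] and
    [O_k = ((1 + x) ^ k - (1 - x) ^ k) / (2 x)], which are polynomials in [y].
    Row [l] of each matrix lists the coefficients of [E_l F_(N-l)], where [F] is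
    [E] or [O] and [N] is [2n] or [2n+1]; with [w = (1 + x) (1 - x) = 1 - y] one has
    [2 E_l F_(N-l) = F_N + w ^ l F_(N-2l)].
    Row operations remove [F_N], and expanding [w ^ l F_(N-2l)] in powers of [w]
    gives a triangular matrix whose diagonal entries are the values at [y = 1]
    of the [F_(N-2l)], i.e. powers of [2]. The change of basis from powers of
    [w] to powers of [y] is triangular with diagonal entries [(-1) ^ j]. *)

Section LucasSequence.

Variable R : comNzRingType.

(** For [w = 1 - x ^ 2] the characteristic polynomial [t ^ 2 - 2 t + w] has roots [1 + x] and
    [1 - x]. *)
Definition lucas_rec (w : R) (F : nat -> R) :=
  forall k, F k.+2 = F k.+1 *+ 2 - w * F k.

(** Two-step induction on [l] with [m] free: the case [l + 2] at [m] rests on [l + 1] at [m + 1] and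
    on [l] at [m + 2]. *)
Lemma lucas_rec_mul (w : R) (E F : nat -> R) (l m : nat) :
    E 0 = 1 -> E 1 = 1 -> lucas_rec w E -> lucas_rec w F ->
  (E l * F (l + m)%N) *+ 2 = F (l.*2 + m)%N + w ^+ l * F m.
Proof.
move=> E0 E1 recE recF.
elim/ltn_ind: l m => -[|[|l]] IHl m; first by rewrite E0 expr0 !mul1r mulr2n.
  by rewrite E1 mul1r recF expr1 subrK.
have:= IHl l.+1 (ltnSn _) m.+1; have := IHl l (ltnW (ltnSn _)) m.+2.
rewrite !doubleS !addSn !addnS recE (recF (l.*2 + m).+2) (recF m) => IH0 IH1.
rewrite mulrBl mulrnBl mulrnAl {}IH1 -mulrA -mulrnAr {}IH0 !exprS.
ring.
Qed.

End LucasSequence.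

Section BinomialPolynomials.

(** [bin_poly 0 k] is [E_k] and [bin_poly 1 k] is [O_k], with ['X] in the role of [y]. *)
Definition bin_poly (e k : nat) : {poly int} :=
  \poly_(j < k.+1) 'C(k, 2 * j + e)%:Z.

Lemma coef_bin_poly e k j : (bin_poly e k)`_j = 'C(k, 2 * j + e)%:Z.
Proof.
by rewrite coef_poly; case: ltnP => // lekj; rewrite bin_small //; lia.
Qed.

Lemma bin_poly0S k : bin_poly 0 k.+1 = bin_poly 0 k + 'X * bin_poly 1 k.
Proof.
apply/polyP => j; rewrite coefD coefXM !coef_bin_poly.
case: j => [|j] /=; first by rewrite !bin0 addr0.
by rewrite !addn0 mulnS binS PoszD addn1.
Qed.

Lemma bin_poly1S k : bin_poly 1 k.+1 = bin_poly 1 k + bin_poly 0 k.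
Proof.
by apply/polyP => j; rewrite coefD !coef_bin_poly addn1 addn0 binS PoszD.
Qed.

Lemma bin_poly_rec (e : bool) : lucas_rec (1 - 'X) (bin_poly e).
Proof.
by case: e => k /=; rewrite ?(bin_poly1S, bin_poly0S); ring.
Qed.

Lemma bin_poly00 : bin_poly 0 0 = 1.
Proof. by apply/polyP => -[|j]; rewrite coef_bin_poly coef1. Qed.

Lemma bin_poly10 : bin_poly 1 0 = 0.
Proof. by apply/polyP => j; rewrite coef_bin_poly coef0 bin_small // addn1. Qed.

Lemma bin_poly01 : bin_poly 0 1 = 1.
Proof. by rewrite bin_poly0S bin_poly00 bin_poly10 mulr0 addr0. Qed.

(** The condition [e <= k] excludes only [O_0 = 0]; the value [E_0 = 1] fits because [0.-1 = 0]. *)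
Lemma horner_bin_poly (e : bool) k :
  (e <= k)%N -> (bin_poly e k).[1] = 2 ^+ k.-1.
Proof.
have horner2 m :
    (bin_poly 0 m.+1).[1] = 2 ^+ m /\ (bin_poly 1 m.+1).[1] = 2 ^+ m.
  elim: m => [|m [IH0 IH1]].
    by rewrite bin_poly01 bin_poly1S bin_poly10 bin_poly00 add0r hornerC.
  rewrite bin_poly0S (bin_poly1S m.+1) !(hornerD, hornerM) hornerX
    IH0 IH1 mul1r exprS.
  by split; ring.
case: e k => -[|k] // _; first by case: (horner2 k).
  by rewrite bin_poly00 hornerC.
by case: (horner2 k).
Qed.

Lemma bin_poly_mul (e : bool) N l : (2 * l <= N)%N ->
  (bin_poly 0 l * bin_poly e (N - l)) *+ 2
    = bin_poly e N + (1 - 'X) ^+ l * bin_poly e (N - 2 * l).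
Proof.
move=> le2lN; have -> : (N - l = l + (N - 2 * l))%N by lia.
rewrite (@lucas_rec_mul _ (1 - 'X)) ?bin_poly00 ?bin_poly01 //.
- by congr (bin_poly e _ + _); lia.
- exact: (bin_poly_rec false).
- exact: bin_poly_rec.
Qed.

End BinomialPolynomials.

Section SubstitutionOneMinusX.

Variable R : comNzRingType.
Implicit Type p : {poly R}.

Lemma comp_poly_1subXK p : (p \Po (1 - 'X)) \Po (1 - 'X) = p.
Proof.
by rewrite -comp_polyA comp_polyB comp_polyX -polyC1 comp_polyC subKr
  comp_polyXr.
Qed.

Lemma size_comp_poly_1subX p n :
  (size p <= n)%N -> (size (p \Po (1 - 'X)) <= n)%N.
Proof.
move=> le_p_n; apply: leq_trans le_p_n; have [->|p0] := eqVneq p 0.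
  by rewrite comp_poly0.
apply: leq_trans (size_comp_poly_leq _ _) _.
have := size_XsubC (1 : R); rewrite -opprB size_polyN => ->.
by rewrite muln1 prednK // size_poly_gt0.
Qed.

(** Substituting [1 - 'X] is an involution that does not raise the size, so the substituted
    polynomial lists the coordinates of [p] in powers of [1 - 'X]. *)
Lemma coef_1subX_basis p n m : (size p <= n)%N ->
  p`_m = \sum_(j < n) (p \Po (1 - 'X))`_j * ((1 - 'X) ^+ j)`_m.
Proof.
move=> le_p_n; rewrite -[in LHS](comp_poly_1subXK p).
have := size_comp_poly_1subX le_p_n; move: (p \Po (1 - 'X)) => q le_q_n.
rewrite coef_comp_poly
  (big_ord_widen _ (fun j => q`_j * ((1 - 'X) ^+ j)`_m) le_q_n).
rewrite big_mkcond; apply: eq_bigr => j _.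
by case: ltnP => // ?; rewrite nth_default ?mul0r.
Qed.

Lemma det_1subX_basis n :
  \det (\matrix_(j < n, m < n) ((1 - 'X) ^+ j : {poly R})`_m)
    = (-1) ^+ 'C(n, 2).
Proof.
have powE j : (1 - 'X) ^+ j = (-1) ^+ j *: ('X - 1%:P) ^+ j :> {poly R}.
  by rewrite -exprZn scaleN1r opprB.
rewrite det_trig.
  rewrite -bin2_sum big_mkord -prodrXr; apply: eq_bigr => j _.
  have /monicP := monic_exp j (monicXsubC (1 : R)).
  by rewrite mxE powE coefZ lead_coefE size_exp_XsubC => ->; rewrite mulr1.
apply/is_trig_mxP => j m ltjm.
by rewrite mxE powE coefZ nth_default ?mulr0 // size_exp_XsubC.
Qed.

End SubstitutionOneMinusX.

Section Determinant.

Variables (e : bool) (N n : nat).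
(** The lower bound gives [e <= N - 2 * l] for [l <= n], as evaluation at [1] requires; the upper
    bound keeps the degree of [P l] at most [n]. *)
Hypotheses (le_n_N : (2 * n + e <= N)%N) (le_N_n : (N <= 2 * n + 1 + e)%N).

Let w : {poly int} := 1 - 'X.
Let P l := bin_poly 0 l * bin_poly e (N - l).
Let Q l := w ^+ l * bin_poly e (N - 2 * l).

Lemma coef_bin_poly_conv l m :
  (P l)`_m = (\sum_(k < m.+1) 'C(l, 2 * k) * 'C(N - l, 2 * (m - k) + e))%N%:Z.
Proof.
rewrite coefM (big_morph Posz PoszD (erefl _)).
by apply: eq_bigr => k _; rewrite !coef_bin_poly addn0 PoszM.
Qed.

Lemma bin_poly_conv_split l : (l <= n)%N -> P l *+ 2 = Q 0 + Q l.
Proof.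
by move=> leln; rewrite bin_poly_mul ?/Q ?muln0 ?subn0 ?mul1r //; lia.
Qed.

(** Coefficients of [P i] beyond [n] vanish. The splitting at [0] reads [2 P_0 = 2 Q_0], which
    settles [Q 0]; the splitting at [l] then settles [Q l]. *)
Lemma size_bin_poly_split l : (l <= n)%N -> (size (Q l) <= n.+1)%N.
Proof.
move=> leln; apply/leq_sizeP => m ltnm.
have P_m i : (i <= n)%N -> (P i)`_m = 0.
  move=> lein; rewrite coef_bin_poly_conv big1 // => k _.
  have [lt_ik | le_ki] := ltnP i (2 * k); first by rewrite bin_small.
  by rewrite ['C(N - i, _)]bin_small ?muln0 //; have := ltn_ord k; lia.
have := bin_poly_conv_split leln; have := bin_poly_conv_split (leq0n n).
move=> /(congr1 (coefp m)) + /(congr1 (coefp m)).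
rewrite /= !coefMn !coefD !P_m // !mul0rn.
move: (Q 0)`_m (Q l)`_m => a b; lia.
Qed.

Lemma det_bin_poly_split :
  \det (\matrix_(l < n.+1, m < n.+1) (Q l)`_m)
    = 2 ^+ (\sum_(l < n.+1) (N - 2 * l).-1) * (-1) ^+ 'C(n.+1, 2).
Proof.
(* Row [l] of [U] holds the coordinates of [Q l] in powers of [w]; the factor ['X^l] makes [U] upper
   triangular. *)
pose U := \matrix_(l < n.+1, j < n.+1) (Q l \Po w)`_j.
have wK : w \Po w = 'X.
  by have := comp_poly_1subXK ('X : {poly int}); rewrite comp_polyX.
have QwE l : Q l \Po w = (bin_poly e (N - 2 * l) \Po w) * 'X^l.
  by rewrite comp_polyM rmorphXn /= wK mulrC.
have -> : \matrix_(l < n.+1, m < n.+1) (Q l)`_m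
    = U *m \matrix_(j < n.+1, m < n.+1) (w ^+ j)`_m.
  apply/matrixP => l m; rewrite !mxE.
  rewrite (@coef_1subX_basis _ _ n.+1) ?size_bin_poly_split -1?ltnS //.
  by apply: eq_bigr => j _; rewrite !mxE.
rewrite det_mulmx det_1subX_basis -det_tr det_trig; last first.
  by apply/is_trig_mxP => j l ltjl; rewrite !mxE QwE coefMXn ltjl.
congr (_ * _); rewrite -prodrXr; apply: eq_bigr => l _.
rewrite !mxE QwE coefMXn ltnn subnn -horner_coef0 horner_comp !hornerE.
rewrite horner_bin_poly //; have := ltn_ord l; lia.
Qed.

(** Doubling all [n + 1] rows costs [2 ^ (n + 1)], and the row operations give back one factor [2],
    so the exponent drops by [n]. *)
Lemma det_bin_conv s : (n + s = \sum_(l < n.+1) (N - 2 * l).-1)%N ->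
  \det (\matrix_(l < n.+1, m < n.+1)
     (\sum_(k < m.+1) 'C(l, 2 * k) * 'C(N - l, 2 * (m - k) + e))%N%:Z)
    = (-1) ^+ ((n * (n + 1)) %/ 2) * 2 ^+ s.
Proof.
move=> sumE; set A := (X in \det X).
(* [T] adds row [0] to every row, itself included, so its diagonal is [2, 1, ..., 1]. *)
pose T : 'M[int]_n.+1 := \matrix_(l, j) ((l == j)%:R + (j == 0)%:R).
have detT : \det T = 2.
  rewrite det_trig.
    by rewrite big_ord_recl big1 ?mxE ?eqxx // => i _; rewrite mxE eqxx.
  apply/is_trig_mxP => i j ltij; rewrite mxE -!val_eqE /= (ltn_eqF ltij).
  by rewrite gtn_eqF //; apply: leq_ltn_trans ltij.
have A2 : 2 *: A = T *m \matrix_(l < n.+1, m < n.+1) (Q l)`_m.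
  apply/matrixP => l m; rewrite !mxE -coef_bin_poly_conv mulr_natl -coefMn.
  rewrite bin_poly_conv_split -1?ltnS // coefD addrC.
  under eq_bigr do rewrite !mxE mulrDl.
  rewrite big_split /= (bigD1 l) //= [X in _ = _ + X](bigD1 0) //=.
  rewrite !big1 ?eqxx ?addr0 ?mul1r // => i.
    by move=> /negPf ->; rewrite mul0r.
  by rewrite eq_sym => /negPf ->; rewrite mul0r.
have := congr1 determinant A2.
rewrite detZ det_mulmx detT det_bin_poly_split -sumE mulrA -exprS -addSn exprD.
rewrite -mulrA => /(mulfI _) ->; last by rewrite expf_neq0.
by rewrite mulrC bin2 -divn2 mulnC addn1.
Qed.

End Determinant.

(* MathComp world. All truncated subtractions on nat are exact here: k <= m,
   l <= n, and n - 1 only occurs multiplied by n; n * (n +/- 1) is even. *)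
Theorem theorem9 :
  [/\ (forall n : nat, (1 <= n)%N ->
         \det (\matrix_(l < n, m < n)
           (\sum_(k < m.+1)
              'C(l, 2 * k) * 'C(2 * n - l, 2 * (m - k) + 1))%N%:Z)
         = (-1) ^+ ((n * (n - 1)) %/ 2) * 2 ^+ (n * (n - 1) + 1)),
      (forall n : nat,
         \det (\matrix_(l < n.+1, m < n.+1)
           (\sum_(k < m.+1)
              'C(l, 2 * k) * 'C(2 * n + 1 - l, 2 * (m - k) + 1))%N%:Z)
         = (-1) ^+ ((n * (n + 1)) %/ 2) * 2 ^+ (n ^ 2)),
      (forall n : nat,
         \det (\matrix_(l < n.+1, m < n.+1)
           (\sum_(k < m.+1)
              'C(l, 2 * k) * 'C(2 * n - l, 2 * (m - k)))%N%:Z)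
         = (-1) ^+ ((n * (n + 1)) %/ 2) * 2 ^+ (n * (n - 1)))
    & (forall n : nat,
         \det (\matrix_(l < n.+1, m < n.+1)
           (\sum_(k < m.+1)
              'C(l, 2 * k) * 'C(2 * n + 1 - l, 2 * (m - k)))%N%:Z)
         = (-1) ^+ ((n * (n + 1)) %/ 2) * 2 ^+ (n ^ 2))].
Proof.
(* For [c = 0] the last summand is the truncated [0.-1 = 0], matched by [c.-1] on the right. *)
have sumE c m :
    (\sum_(l < m.+1) (2 * m + c - 2 * l).-1 = m * m + c * m + c.-1)%N.
  elim: m => [|m IHm]; first by rewrite big_ord1 /=; lia.
  rewrite big_ord_recl (eq_bigr (fun l : 'I_m.+1 => (2 * m + c - 2 * l).-1)).
    by rewrite IHm /=; lia.
  by move=> l _; rewrite lift0; lia.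
split=> [[//|n] _|n|n|n].
(* Here the matrix has size [n.+1] and [N = 2 * n + 2], the case [c = 2] of [sumE]. *)
- rewrite (@det_bin_conv true _ _ _ _ (n.+1 * (n.+1 - 1) + 1)); try lia.
    by congr (_ ^+ (_ %/ 2) * _); lia.
  rewrite (_ : 2 * n.+1 = 2 * n + 2)%N; last by lia.
  by rewrite sumE; lia.
- by apply: (@det_bin_conv true); rewrite ?sumE; lia.
- under eq_mx => l m do under eq_bigr => k _ do rewrite -[(2 * (m - k))%N]addn0.
  apply: (@det_bin_conv false); try lia.
  by have := sumE 0 n; rewrite addn0 => ->; case: n => [|n]; lia.
- under eq_mx => l m do under eq_bigr => k _ do rewrite -[(2 * (m - k))%N]addn0.
  by apply: (@det_bin_conv false); rewrite ?sumE; lia.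
Qed.
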